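(* Let $n\ge2$ and for $1\le i\le n$ let $\mathcal{K}_i$ be a Galois extension of $\mathbb{F}_q(t)$ of degree $r_i\ge2$, and assume $\mathcal{K}_1,\dots,\mathcal{K}_n$ are pairwise linearly disjoint over $\mathbb{F}_q(t)$. Let $G_i:=\mathrm{Res}_{\mathcal{K}_i/\mathbb{F}_q(t)}(\mathbb{G}_{m/\mathcal{K}_i})$, viewed inside $\mathrm{GL}_{r_i}$ via the regular representation, so that $\det$ on $G_i$ is the norm $N_{\mathcal{K}_i/\mathbb{F}_q(t)}$. For $m\ge1$ let $T_m:=\{(\gamma_1,\dots,\gamma_m)\in G_1\times\dots\times G_m:\det\gamma_i=\det\gamma_j\text{ for all }i,j\}$. Let $\pi_{[n]}:G_1\times\dots\times G_n\to G_1\times\dots\times G_{n-1}$ and $\pi_n:G_1\times\dots\times G_n\to G_n$ be the projections. Suppose $\mathcal{G}\subset T_n$ is an $\mathbb{F}_q(t)$-subtorus with $\pi_{[n]}(\mathcal{G})=T_{n-1}$ and $\pi_n(\mathcal{G})=G_n$. Then $\mathcal{G}=T_n$.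
   Context: $\mathbb{F}_q$ is a finite field and $t$ an indeterminate; $\mathrm{Res}$ denotes Weil restriction of scalars; all groups are linear algebraic groups over $\mathbb{F}_q(t)$. *)

(* Defs.v *)
From HB Require Import structures.
From mathcomp Require Export all_boot all_order all_fingroup all_algebra.
From mathcomp Require Export all_field.
From mathcomp Require Export mpoly.

Set Implicit Arguments.
Unset Strict Implicit.
Unset Printing Implicit Defensive.

Import GRing.Theory.
Local Open Scope ring_scope.

(* The rational function field F(t). *)
Notation ratfun F := {fraction {poly F}}.

(* Linear algebraic groups over k are taken in the classical (Borel) sense:   *)
(* Zariski closed subgroups of GL_N(Omega), Omega an algebraically closed     *)
(* extension of k through iota, whose vanishing ideal is generated by         *)
(* polynomials with coefficients in k.  Over an imperfect k this is stronger  *)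
(* than being the zero locus of polynomials over k.                           *)
Section LinearAlgebraicGroups.
Variables (k : fieldType) (Omega : closedFieldType).
Variable iota : {rmorphism k -> Omega}.

Definition mxeval (N : nat) (p : {mpoly Omega[N * N]}) (A : 'M[Omega]_N) :
  Omega := p.@[fun e => mxvec A 0 e].

Definition vanishes_on (N : nat) (X : 'M[Omega]_N -> Prop)
    (p : {mpoly Omega[N * N]}) : Prop :=
  forall A, X A -> mxeval p A = 0.

Definition closed_in_GL (N : nat) (X : 'M[Omega]_N -> Prop) : Prop :=
  exists S : {mpoly Omega[N * N]} -> Prop,
    forall A, X A <-> A \in unitmx /\ (forall p, S p -> mxeval p A = 0).

Definition subgroup_of_GL (N : nat) (X : 'M[Omega]_N -> Prop) : Prop :=
  [/\ forall A, X A -> A \in unitmx,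
      X 1%:M,
      forall A B, X A -> X B -> X (A *m B)
    & forall A, X A -> X (invmx A)].

Definition defined_over (N : nat) (X : 'M[Omega]_N -> Prop) : Prop :=
  forall p : {mpoly Omega[N * N]}, vanishes_on X p ->
    exists (m : nat) (c : 'I_m -> {mpoly Omega[N * N]})
           (f : 'I_m -> {mpoly k[N * N]}),
      (forall l, vanishes_on X (map_mpoly iota (f l))) /\
      p = \sum_(l < m) c l * map_mpoly iota (f l).

Definition algebraic_group_over (N : nat) (X : 'M[Omega]_N -> Prop) : Prop :=
  [/\ subgroup_of_GL X, closed_in_GL X & defined_over X].

(* The regular functions on GL_N are Omega[x_ij][1/det]. *)
Definition regular_on (N : nat) (X : 'M[Omega]_N -> Prop)
    (f : 'M[Omega]_N -> Omega) : Prop :=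
  exists (p : {mpoly Omega[N * N]}) (e : nat),
    forall A, X A -> f A = mxeval p A / (\det A) ^+ e.

Definition group_morphism (N M : nat) (X : 'M[Omega]_N -> Prop)
    (Y : 'M[Omega]_M -> Prop) (f : 'M[Omega]_N -> 'M[Omega]_M) : Prop :=
  [/\ forall A, X A -> Y (f A),
      forall A B, X A -> X B -> f (A *m B) = f A *m f B
    & forall i j, regular_on X (fun A => f A i j)].

Definition group_isomorphic (N M : nat) (X : 'M[Omega]_N -> Prop)
    (Y : 'M[Omega]_M -> Prop) : Prop :=
  exists (f : 'M[Omega]_N -> 'M[Omega]_M) (g : 'M[Omega]_M -> 'M[Omega]_N),
    [/\ group_morphism X Y f,
        group_morphism Y X g,
        forall A, X A -> g (f A) = A
      & forall B, Y B -> f (g B) = B].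

(* G_m^d, as the group of invertible diagonal matrices. *)
Definition diagonal_group (d : nat) (A : 'M[Omega]_d) : Prop :=
  is_diag_mx A /\ A \in unitmx.

Definition torus_over (N : nat) (X : 'M[Omega]_N -> Prop) : Prop :=
  algebraic_group_over X /\
  exists d : nat, group_isomorphic X (@diagonal_group d).

End LinearAlgebraicGroups.

(* A and B are linearly disjoint over the base field k when k-free families   *)
(* of elements of A stay free over B.                                         *)
Definition linearly_disjoint (k : fieldType) (L : fieldExtType k)
    (A B : {subfield L}) : Prop :=
  forall (m : nat) (x : m.-tuple L),
    (forall l, tnth x l \in A) -> free x ->
    forall c : 'I_m -> L, (forall l, c l \in B) ->
      \sum_(l < m) c l * tnth x l = 0 -> forall l, c l = 0.

Section WeilRestriction.
Variables (k : fieldType) (Omega : closedFieldType).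
Variable iota : {rmorphism k -> Omega}.
Variables (L : fieldExtType k) (r : nat) (b : r.-tuple L).

(* Matrix, in the basis b of a subfield E of L, of multiplication by x in E. *)
Definition regular_rep (x : L) : 'M[k]_r :=
  \matrix_(i, j) coord b j (tnth b i * x).

(* Matrix of multiplication by \sum_l a_l (x) b_l in Omega (x)_k E. *)
Definition tensor_rep (a : 'rV[Omega]_r) : 'M[Omega]_r :=
  \sum_(l < r) a 0 l *: map_mx iota (regular_rep (tnth b l)).

(* Res_{E/k}(G_m)(Omega) = (Omega (x)_k E)^*, inside GL_r(Omega) through the  *)
(* regular representation, when b is a basis of E over k.                     *)
Definition ResGm (A : 'M[Omega]_r) : Prop :=
  exists a a' : 'rV[Omega]_r,
    A = tensor_rep a /\ tensor_rep a *m tensor_rep a' = 1%:M.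

End WeilRestriction.

Section EqualNormTorus.
Variables (k : fieldType) (Omega : closedFieldType).
Variable iota : {rmorphism k -> Omega}.
Variable L : fieldExtType k.

Definition mxfamily (m : nat) (r : 'I_m -> nat) :=
  {dffun forall i : 'I_m, 'M[Omega]_(r i)}.

(* GL_{r_1} x ... x GL_{r_m} inside GL_{r_1 + ... + r_m}. *)
Definition block_diagonal (m : nat) (r : 'I_m -> nat)
    (X : mxfamily r -> Prop) (A : 'M[Omega]_(\sum_i r i)) : Prop :=
  exists g : mxfamily r, X g /\ A = \mxdiag_i g i.

Definition equal_det_group (m : nat) (r : 'I_m -> nat)
    (b : forall i, (r i).-tuple L) (g : mxfamily r) : Prop :=
  (forall i, ResGm iota (b i) (g i)) /\
  (forall i j, \det (g i) = \det (g j)).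

Definition proj_init (n : nat) (r : 'I_n.+1 -> nat) (g : mxfamily r) :
    mxfamily (fun i : 'I_n => r (widen_ord (leqnSn n) i)) :=
  [ffun i : 'I_n => g (widen_ord (leqnSn n) i)].

Definition proj_last (n : nat) (r : 'I_n.+1 -> nat) (g : mxfamily r) :
    'M[Omega]_(r ord_max) := g ord_max.

End EqualNormTorus.

(* Applied to Omega-points: as Omega is algebraically closed, the image of a  *)
(* morphism of algebraic groups has the images of the points as its points.   *)
Definition image_eq (S T : Type) (f : S -> T) (X : S -> Prop)
    (Y : T -> Prop) : Prop :=
  forall y, Y y <-> exists2 x, X x & f x = y.

(* Main.v *)
(* Over Omega each G_i becomes a product of copies of G_m indexed by Gal(K_i), *)
(* and det becomes the product of the coordinates.  A closed subgroup is cut   *)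
(* out by equalities between monomials in these coordinates; being defined     *)
(* over k, it is stable under the permutations of the coordinates induced by   *)
(* Galois (Artin's independence of characters replaces an action of Galois on  *)
(* Omega).  Let h be a Galois element that is trivial on K_n.  If (g', c) is   *)
(* in G then so is its permuted version (h g', c), hence also (h g' / g', 1).  *)
(* Since g' ranges over T_(n-1) and, by linear disjointness, h can induce any  *)
(* element of Gal(K_i) for i < n, these quotients generate the product of the  *)
(* norm-one tori of the G_i with i < n, and G -> G_n being onto gives G = T_n. *)

From Stdlib Require Import Classical ClassicalEpsilon.
From HB Require Import structures.
Require Import Defs.

Set Implicit Arguments.
Unset Strict Implicit.
Unset Printing Implicit Defensive.

Import GRing.Theory.
Local Open Scope ring_scope.

(** Write [k] for F_q(t) and fix a [k]-embedding [psi] of [L] in [Omega] ([closed_embedding]).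
    Conjugation by the matrix of Galois conjugates of a basis turns each G_i into the invertible
    diagonal matrices, with det the product of the entries ([ResGmP]). The crux is [twist_mem]:
    replacing [psi] by another [k]-embedding in the conjugating matrix, with the diagonal entries
    unchanged, preserves membership in a [k]-group. Indeed equations over [k] become linear
    relations among monomial characters, and such relations survive a change of embedding of their
    coefficients ([sum_chi0_morph]). Taking [psi \o h] with [h] an automorphism of [L] gives
    stability under Galois permutations of the coordinates ([G_fam_perm]).

    For i < n, linear disjointness gives an [h] moving any chosen coordinate of G_i to any other
    while fixing those of G_n ([linearly_disjoint_gal]). Lift an element of T_(n-1) to the subgroup
    and divide its twist by it: the unknown G_n component cancels. This yields elements with [x] and
    its inverse at two places of one block ([G_elementary]), which generate all norm-one elements
    with trivial last component ([G_norm1]). Surjectivity onto G_n then reduces any point of T_n to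
    that case ([G_full]). In the code there are [n.+1] factors, and the last has index [ord_max]. *)

(** * Independence of multiplicative characters on a monoid *)

Section CharacterIndependence.
Variables (Omega : fieldType) (T : Type) (mul : T -> T -> T) (one : T).
Variable Z : T -> Prop.
Hypotheses (Z1 : Z one) (ZM : forall x y, Z x -> Z y -> Z (mul x y)).
Variables (I : eqType) (chi : I -> T -> Omega).
Hypotheses (chi1 : forall i, chi i one = 1)
  (chiM : forall i x y, chi i (mul x y) = chi i x * chi i y).

Definition agree_on (i j : I) : bool :=
  if excluded_middle_informative (forall x, Z x -> chi i x = chi j x)
  then true else false.

Lemma agree_onP i j :
  reflect (forall x, Z x -> chi i x = chi j x) (agree_on i j).
Proof.
by rewrite /agree_on; case: excluded_middle_informative => h; constructor.
Qed.

(** Artin's independence argument, for characters that may coincide on [Z]: induction on the number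
    of indices outside the class of [i0]. When none is left, evaluating at [one] gives the claim. *)
Lemma class_sum0 (s : seq I) (v : I -> Omega) (i0 : I) :
  (forall x, Z x -> \sum_(i <- s) v i * chi i x = 0) ->
  \sum_(i <- s | agree_on i0 i) v i = 0.
Proof.
have [m] := ubnP (count (predC (agree_on i0)) s).
elim: m => // m IHm in s v *; rewrite ltnS => les sum0.
have [|] := boolP (has (predC (agree_on i0)) s); last first.
  rewrite -all_predC => /allP als; rewrite -[RHS](sum0 _ Z1).
  rewrite big_seq_cond [RHS]big_seq; apply: eq_big => [i|i _].
    by have [/als/=|] := boolP (i \in s); rewrite ?negbK // => ->.
  by rewrite chi1 mulr1.
case/hasP => j sj /= nej.
have [x Zx neqx] : exists2 x, Z x & chi i0 x <> chi j x.
  apply: NNPP => nex; case/agree_onP: nej => x Zx; apply: NNPP => ne.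
  by apply: nex; exists x.
(* These are the coefficients of the relation at [mul x y] minus [chi j x] times the relation at
   [y]. The index [j] drops out, and the class sum of [i0] is only multiplied by the nonzero
   [chi i0 x - chi j x]. *)
have := IHm (filter (predC1 j) s) (fun i => v i * (chi i x - chi j x)).
rewrite !big_filter_cond => IH.
have {IH} : \sum_(i <- s | predC1 j i && agree_on i0 i)
      v i * (chi i x - chi j x) = 0.
  apply: IH => [|y Zy].
    apply: leq_trans les.
    have /permPl/seq.permP <- := perm_filterC (predC1 j) s.
    rewrite count_cat -[ltnLHS]addn0 ltn_add2l -has_count.
    by apply/hasP; exists j; rewrite ?mem_filter /= ?negbK ?eqxx.
  rewrite big_filter (_ : \sum_(i <- s | _) _ =
     \sum_(i <- s) v i * chi i (mul x y) -
     chi j x * \sum_(i <- s) v i * chi i y).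
    by rewrite !sum0 ?mulr0 ?subr0 //; apply: ZM.
  rewrite mulr_sumr -sumrB big_mkcond; apply: eq_bigr => i _ /=.
  case: eqVneq => [->|_] /=; rewrite chiM; first by rewrite mulrCA subrr.
  by rewrite mulrBr mulrBl mulrA; congr (_ - _); rewrite [RHS]mulrCA mulrA.
have -> : \sum_(i <- s | predC1 j i && agree_on i0 i) v i * (chi i x - chi j x)
   = (\sum_(i <- s | agree_on i0 i) v i) * (chi i0 x - chi j x).
  rewrite mulr_suml; apply: eq_big => [i|i /andP[_ /agree_onP/(_ x Zx)->] //].
  by rewrite /=; case: eqVneq => // ->; rewrite (negPf nej).
by move/eqP; rewrite mulf_eq0 subr_eq0 => /orP[/eqP|/eqP].
Qed.

(* The relations among the characters are generated by those with integer     *)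
(* coefficients, so they do not depend on the embedding of the coefficients.  *)
Lemma sum_chi0_morph (L : fieldType) (psi psi' : {rmorphism L -> Omega})
    (s : seq I) (c : I -> L) :
  (forall x, Z x -> \sum_(i <- s) psi (c i) * chi i x = 0) ->
  forall x, Z x -> \sum_(i <- s) psi' (c i) * chi i x = 0.
Proof.
have [m] := ubnP (size s); elim: m => // m IHm in s *.
case: s => [_ _ x _|i0 s les sum0 x Zx]; first by rewrite big_nil.
(* Injectivity of [psi] brings the vanishing down to [L], where it no longer depends on the
   embedding; the whole class of [i0] can then be discarded. *)
have /eqP := class_sum0 i0 sum0; rewrite -raddf_sum fmorph_eq0 => /eqP c0.
have red (f : {rmorphism L -> Omega}) y : Z y ->
    \sum_(i <- i0 :: s) f (c i) * chi i y =
    \sum_(i <- [seq i <- i0 :: s | ~~ agree_on i0 i]) f (c i) * chi i y.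
  move=> Zy; rewrite big_filter (bigID (agree_on i0)) /=.
  rewrite [X in X + _](_ : _ = 0) ?add0r //.
  transitivity (f (\sum_(i <- i0 :: s | agree_on i0 i) c i) * chi i0 y).
    rewrite raddf_sum mulr_suml; apply: eq_bigr => i /agree_onP/(_ _ Zy)->//.
  by rewrite c0 rmorph0 mul0r.
rewrite red //; apply: IHm => [|y Zy|//]; last by rewrite -red ?sum0.
rewrite /= (_ : agree_on i0 i0); last exact/agree_onP.
by rewrite size_filter (leq_ltn_trans (count_size _ _)).
Qed.

End CharacterIndependence.

(** * Points of a [k]-group under a change of embedding *)

Section Twist.
Variables (k : fieldType) (Omega : closedFieldType).
Variable iota : {rmorphism k -> Omega}.
Variables (L : fieldExtType k) (N : nat) (B : 'M[L]_N).
Hypothesis unitB : B \in unitmx.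

Definition conj_diag (C : 'M[Omega]_N) (d : 'rV[Omega]_N) : 'M[Omega]_N :=
  C *m diag_mx d *m invmx C.

Let mulrow (d d' : 'rV[Omega]_N) : 'rV[Omega]_N := \row_i (d 0 i * d' 0 i).

Lemma conj_diagM C d d' : C \in unitmx ->
  conj_diag C d *m conj_diag C d' = conj_diag C (mulrow d d').
Proof.
by move=> uC; rewrite /conj_diag !mulmxA mulmxKV // -(mulmxA C) mulmx_diag.
Qed.

Lemma conj_diag1 C : C \in unitmx -> conj_diag C (const_mx 1) = 1%:M.
Proof. by move=> uC; rewrite /conj_diag diag_const_mx mulmx1 mulmxV. Qed.

Let generic_conj : 'M[{mpoly L[N]}]_N :=
  map_mx (@mpolyC N L) B *m diag_mx (\row_s 'X_s)
    *m map_mx (@mpolyC N L) (invmx B).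

Let pullback (f : {mpoly k[N * N]}) : {mpoly L[N]} :=
  mmap (@mpolyC N L \o in_alg L) (fun e => mxvec generic_conj 0 e) f.

(** On conjugates of diagonal matrices, a polynomial over [k] is a combination of monomial
    characters of [d]; [psi] enters only through the coefficients. *)
Lemma mxeval_conj_diag (psi : {rmorphism L -> Omega}) f d :
  (forall a, psi a%:A = iota a) ->
  mxeval (map_mpoly iota f) (conj_diag (map_mx psi B) d) =
  \sum_(m <- msupp (pullback f)) psi (pullback f)@_m * \prod_s d 0 s ^+ m s.
Proof.
move=> psiE.
pose ev : {rmorphism {mpoly L[N]} -> Omega} := mmap psi (fun s => d 0 s).
transitivity (ev (pullback f)); last by [].
have evX s : ev 'X_s = d 0 s by rewrite /ev /= mmapX mmap1U.
have evC c : ev c%:MP = psi c by rewrite /ev /= mmapC.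
have evconj : map_mx ev generic_conj = conj_diag (map_mx psi B) d.
  rewrite /generic_conj !map_mxM /conj_diag -map_invmx; congr (_ *m _ *m _).
  - by apply/matrixP => i j; rewrite !mxE; apply: evC.
  - apply/matrixP => i j; rewrite !mxE.
    by case: (i == j); [apply: evX | apply: raddf0].
  - by apply/matrixP => i j; rewrite !mxE; apply: evC.
rewrite /mxeval -evconj -map_mxvec raddf_sum [RHS]raddf_sum.
apply: eq_bigr => m _; rewrite [LHS]/= mevalM.
rewrite [RHS](rmorphM ev); congr (_ * _).
  by rewrite mevalC; symmetry; apply: etrans (evC _) (psiE _).
rewrite /mmap1 !rmorph_prod; apply: eq_bigr => e _.
by rewrite !rmorphXn /= mevalXU mxE.
Qed.

Lemma twist_mem (X : 'M[Omega]_N -> Prop)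
    (psi psi' : {rmorphism L -> Omega}) d :
  algebraic_group_over iota X ->
  (forall a, psi a%:A = iota a) -> (forall a, psi' a%:A = iota a) ->
  X (conj_diag (map_mx psi B) d) -> X (conj_diag (map_mx psi' B) d).
Proof.
move=> [[Xunit X1 XM _] [S Scl] Xdef] psiE psi'E Xd.
have uB (f : {rmorphism L -> Omega}) : map_mx f B \in unitmx.
  by rewrite map_unitmx.
apply/Scl; split.
  have := Xunit _ Xd; rewrite /conj_diag !unitmx_mul !unitmx_inv !uB /=.
  by rewrite !andbT.
(* The equation [p] has coefficients in [Omega]; being defined over [k] reduces it to equations
   [f l] over [k], to which the change of embedding applies. *)
move=> p Sp; have /Xdef[m [c [f [f0 ->]]]] : vanishes_on X p.
  by move=> A /Scl[_]; apply.
rewrite /mxeval raddf_sum big1 // => l _; rewrite /= mevalM -!/(mxeval _ _).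
rewrite (mxeval_conj_diag _ _ psi'E) (@sum_chi0_morph _ _ mulrow (const_mx 1)
  (fun d => X (conj_diag (map_mx psi B) d)) _ _ _
  (fun (m : 'X_{1..N}) d => \prod_s d 0 s ^+ m s) _ _ _ psi) ?mulr0 //.
- by rewrite conj_diag1.
- by move=> x y Xx Xy; rewrite -conj_diagM //; apply: XM.
- by move=> i; rewrite big1 // => s _; rewrite mxE expr1n.
- move=> i x y; rewrite -big_split; apply: eq_bigr => s _.
  by rewrite mxE exprMn.
- by move=> x Xx; rewrite -(mxeval_conj_diag _ _ psiE) f0.
Qed.

End Twist.

(** * Common eigenvectors, the regular representation, and an embedding of [L] in [Omega] *)

Lemma closed_eigenvalue (Omega : closedFieldType) n (A : 'M[Omega]_n) :
  (0 < n)%N -> exists a, eigenvalue A a.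
Proof.
move=> n_gt0; have /closed_rootP[a Aa] : size (char_poly A) != 1%N.
  by rewrite size_char_poly eqSS -lt0n.
by exists a; rewrite eigenvalue_root_char.
Qed.

(** Stability under everything commuting with [As] is what drives the induction: the next matrix
    restricts to [W] and has an eigenvalue there. *)
Lemma common_eigenspace (Omega : closedFieldType) n (As : seq 'M[Omega]_n) :
  (0 < n)%N -> {in As &, forall A C, comm_mx A C} ->
  exists W : 'M[Omega]_n,
    [/\ W != 0, {in As, forall A, exists a, W *m A = a *: W}
      & forall C, {in As, forall A, comm_mx A C} -> stablemx W C].
Proof.
move=> n_gt0; elim: As => [_|A As IHAs cAs].
  exists 1%:M; split=> [||C _]; [|by []|exact: submx1].
  apply/negP => /eqP/(congr1 mxrank)/eqP.
  by rewrite mxrank1 mxrank0 -leqn0 leqNgt n_gt0.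
have [|W [nzW Wa Wst]] := IHAs.
  by move=> A1 A2 A1s A2s; apply: cAs; rewrite inE ?A1s ?A2s orbT.
have WA : stablemx W A.
  by apply: Wst => A1 A1s; apply: cAs; rewrite inE ?A1s ?eqxx ?orbT.
have [|a /eigenvalueP[v va nzv]] := closed_eigenvalue (restrictmx W A).
  by rewrite lt0n mxrank_eq0.
have vE : (v *m row_base W <= eigenspace A a)%MS.
  rewrite -sub_eigenspace_conjmx ?row_base_free ?stablemx_row_base //.
  exact/eigenspaceP.
have vW : (v *m row_base W <= W)%MS by rewrite mulmx_sub ?eq_row_base.
exists (W :&: eigenspace A a)%MS; split=> [|A1|C cC].
- apply: contra_neq nzv => W0; apply/eqP.
  rewrite -(mulmx_free_eq0 _ (row_base_free W)) -submx0 -W0.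
  by rewrite sub_capmx vW.
- rewrite inE => /predU1P[->|/Wa[c Wc]].
    by exists a; apply/eigenspaceP/capmxSr.
  exists c; have /submxP[D ->] := capmxSl W (eigenspace A a).
  by rewrite -mulmxA Wc scalemxAr.
- rewrite sub_capmx; apply/andP; split.
    apply: submx_trans (Wst C _); first exact/submxMr/capmxSl.
    by move=> A1 A1s; apply: cC; rewrite inE A1s orbT.
  apply: submx_trans (submxMr _ (capmxSr _ _)) _.
  by apply: comm_mx_stable_eigenspace; apply: cC; rewrite inE eqxx.
Qed.

Section RegularRep.
Variables (k : fieldType) (L : fieldExtType k) (E : {subfield L}).
Variables (r : nat) (b : r.-tuple L).
Hypothesis bE : basis_of E b.

Lemma mem_tnth_basis i : tnth b i \in E.
Proof. by apply: (basis_mem bE); rewrite mem_tnth. Qed.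

Lemma coord_tnth i j : coord b j (tnth b i) = (i == j)%:R.
Proof. by rewrite (tnth_nth 0) coord_free // (basis_free bE). Qed.

Lemma coord_sum x : x \in E -> x = \sum_j coord b j x *: tnth b j.
Proof.
move=> Ex; rewrite {1}(coord_basis bE Ex); apply: eq_bigr => j _.
by rewrite (tnth_nth 0).
Qed.

Lemma regular_rep_sum x i : x \in E ->
  tnth b i * x = \sum_j regular_rep b x i j *: tnth b j.
Proof.
move=> Ex; rewrite {1}(coord_sum (rpredM (mem_tnth_basis i) Ex)).
by apply: eq_bigr => j _; rewrite mxE.
Qed.

Lemma regular_repM x y : x \in E ->
  regular_rep b (x * y) = regular_rep b x *m regular_rep b y.
Proof.
move=> Ex; apply/matrixP => i j; rewrite !mxE mulrA (regular_rep_sum _ Ex).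
rewrite mulr_suml linear_sum; apply: eq_bigr => l _ /=.
by rewrite -scalerAl linearZ !mxE.
Qed.

Lemma regular_rep1 : regular_rep b 1 = 1%:M.
Proof. by apply/matrixP => i j; rewrite !mxE mulr1 coord_tnth. Qed.

Lemma regular_repZD a x y :
  regular_rep b (a *: x + y) = a *: regular_rep b x + regular_rep b y.
Proof.
by apply/matrixP => i j; rewrite !mxE mulrDr -scalerAr linearP.
Qed.

HB.instance Definition _ :=
  GRing.isLinear.Build k L 'M[k]_r _ (regular_rep b) regular_repZD.

End RegularRep.

(** The multiplications by elements of [L] are commuting matrices; on a common eigenspace, the
    eigenvalue as a function of [x] is a [k]-linear ring morphism. *)
Lemma closed_embedding (k : fieldType) (Omega : closedFieldType)
    (iota : {rmorphism k -> Omega}) (L : fieldExtType k) :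
  exists psi : {rmorphism L -> Omega}, forall a, psi a%:A = iota a.
Proof.
pose b := vbasis {:L}; have bE : basis_of {:L}%AS b by exact: vbasisP.
pose R x := map_mx iota (regular_rep b x).
have RM x y : R (x * y) = R x *m R y.
  by rewrite /R (regular_repM bE) ?memvf // map_mxM.
have [||W [nzW Wa _]] := @common_eigenspace Omega _ [seq R x | x <- b].
- by rewrite adim_gt0.
- move=> _ _ /mapP[x _ ->] /mapP[y _ ->].
  by rewrite /comm_mx -!RM mulrC.
have {}Wa l : exists a, W *m R (tnth b l) == a *: W.
  have [|a Wl] := Wa (R (tnth b l)); first by rewrite map_f ?mem_tnth.
  by exists a; rewrite Wl.
pose lam l := xchoose (Wa l).
have lamP l : W *m R (tnth b l) = lam l *: W by apply/eqP/(xchooseP (Wa l)).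
pose psi x := \sum_l iota (coord b l x) * lam l.
have psiP x : W *m R x = psi x *: W.
  rewrite {1}(coord_sum bE (memvf x)) /R linear_sum map_mx_sum mulmx_sumr.
  rewrite scaler_suml.
  apply: eq_bigr => l _; rewrite linearZ map_mxZ -scalemxAr -/(R _) lamP.
  by rewrite scalerA.
have Winj a c : a *: W = c *: W -> a = c.
  move/eqP; rewrite -subr_eq0 -scalerBl scaler_eq0 (negPf nzW) orbF subr_eq0.
  by move/eqP.
have psiB : zmod_morphism psi.
  move=> x y; rewrite /psi -sumrB; apply: eq_bigr => l _.
  by rewrite linearB rmorphB mulrBl.
have psiMM : monoid_morphism psi.
  split=> [|x y]; apply: Winj; rewrite -psiP.
    by rewrite /R (regular_rep1 bE) map_mx1 mulmx1 scale1r.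
  by rewrite RM mulmxA psiP -scalemxAl psiP scalerA.
pose zm := GRing.isZmodMorphism.Build _ _ psi psiB.
pose mm := GRing.isMonoidMorphism.Build _ _ psi psiMM.
exists (HB.pack psi zm mm : {rmorphism L -> Omega}) => a /=; apply: Winj.
rewrite -psiP /R linearZ /= (regular_rep1 bE) map_mxZ map_mx1 -scalemxAr mulmx1.
by [].
Qed.

(** * Linear disjointness and extension of automorphisms *)

(** If the degree dropped over [M], the powers of [x] up to that smaller degree would be free over
    [k], yet the monic [minPoly M x] would be a relation between them over [M]. *)
Lemma linearly_disjoint_minPoly (k : fieldType) (L : fieldExtType k)
    (K M : {subfield L}) (x : L) :
  linearly_disjoint K M -> x \in K -> minPoly M x = minPoly 1 x.
Proof.
move=> dKM xK; apply/eqP; rewrite -eqp_monic ?monic_minPoly //.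
rewrite -dvdp_size_eqp ?minPolyS ?sub1v // eqn_leq.
rewrite dvdp_leq ?monic_neq0 ?monic_minPoly ?minPolyS ?sub1v //=.
rewrite leqNgt; apply/negP => lt_sz.
pose p := minPoly M x; have p_gt0 : (0 < size p)%N.
  by rewrite size_poly_gt0 monic_neq0 ?monic_minPoly.
pose X := [tuple x ^+ i | i < size p].
have freeX : free X.
  apply/freeP => c; under eq_bigr do rewrite -tnth_nth tnth_mktuple.
  move=> c0; pose q :=
    \poly_(l < size p) (if insub l is Some i then (c i)%:A else 0 : L).
  have q1 : q \is a polyOver 1%VS.
    apply/polyOver_poly => l _; case: insubP => [i _ _|_]; last exact: mem0v.
    by rewrite rpredZ ?mem1v.
  have qx : root q x.
    rewrite /root horner_poly -[X in _ == X]c0; apply/eqP/eq_bigr => l _.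
    by rewrite valK mulr_algl.
  have q0 : q = 0.
    apply/eqP; apply: contraTT lt_sz => nzq; rewrite -leqNgt.
    exact: leq_trans (dvdp_leq nzq (minPoly_dvdp q1 qx)) (size_poly _ _).
  move=> i; have /eqP := coef0 L i; rewrite -q0 coef_poly ltn_ord valK.
  by rewrite scaler_eq0 oner_eq0 orbF => /eqP.
have XK l : tnth X l \in K by rewrite tnth_mktuple rpredX.
have pM (l : 'I_(size p)) : p`_l \in M by exact: (polyOverP (minPolyOver M x)).
have sum0 : \sum_(l < size p) p`_l * tnth X l = 0.
  under eq_bigr do rewrite tnth_mktuple; rewrite -horner_coef.
  exact: minPolyxx.
have lt_p : ((size p).-1 < size p)%N by rewrite prednK.
have /eqP := dKM _ X XK freeX _ pM sum0 (Ordinal lt_p).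
rewrite /= -lead_coefE (monicP (monic_minPoly _ _)).
by rewrite oner_eq0.
Qed.

(** For a primitive element [x] of [K], [s x] is still a root of the minimal polynomial of [x] over
    [M]. So the identity of [M] extends to M(x) by sending [x] to [s x], and then to [L], a
    splitting field. *)
Lemma linearly_disjoint_gal (k : fieldType) (L : splittingFieldType k)
    (K M : {subfield L}) (s : gal_of K) :
  separable 1 K -> linearly_disjoint K M ->
  exists h : 'AEnd(L), {in M, h =1 id} /\ {in K, h =1 s}.
Proof.
move=> sepK dKM; pose x := separable_generator 1 K.
have Kx : (K : {vspace L}) = <<1; x>>%VS.
  exact: (eq_adjoin_separable_generator sepK (sub1v _)).
have xK : x \in K by rewrite Kx memv_adjoin.
have minE : minPoly M x = minPoly 1 x.
  by rewrite (linearly_disjoint_minPoly dKM xK).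
have hom1 : kHom M M \1 by apply: kHom1.
have rt : root (map_poly (\1%VF : 'End(L)) (minPoly M x)) (s x).
  rewrite (_ : map_poly _ _ = minPoly M x); last first.
    by apply: (kHom_poly_id hom1); apply: minPolyOver.
  rewrite minE; apply: (kHom_root_id (sub1v _) (k1AHom K s) _ xK).
    exact: minPolyOver.
  exact: root_minPoly.
have homE := kHomExtendP (subvv M) hom1 rt.
have [h hE] := kHom_to_AEnd homE.
have hM : {in M, h =1 id}.
  move=> y My; rewrite -hE ?(subvP (subv_adjoin _ _)) //.
  by rewrite (kHomExtend_id _ _ _ My) lfunE.
have hx : h x = s x.
  by rewrite -hE ?memv_adjoin // (kHomExtend_val hom1 rt).
exists h; split=> // y Ky.
have /Fadjoin_polyP[p p1 ->] : y \in <<1; x>>%VS by rewrite -Kx.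
by rewrite -!horner_map /= hx; congr (_.[_]);
  rewrite !(kHom_poly_id (k1AHom {:L} _)) ?p1.
Qed.

(** * Block-diagonal matrices and conjugates of diagonal ones *)

Lemma invmx_uniq (R : comUnitRingType) n (A C : 'M[R]_n) :
  A *m C = 1%:M -> invmx A = C.
Proof.
move=> AC1; have [uA _] := mulmx1_unit AC1.
by rewrite -[C](mulKmx uA) AC1 mulmx1.
Qed.

Lemma mul_mxdiag (R : pzSemiRingType) p (p_ : 'I_p -> nat)
    (C D : forall i, 'M[R]_(p_ i)) :
  \mxdiag_i C i *m \mxdiag_i D i = \mxdiag_i (C i *m D i).
Proof.
rewrite [X in _ *m X]/mxdiag mul_mxdiag_mxblock; apply: eq_mxblock => i j.
by case: eqVneq => [<-|_]; rewrite ?conform_mx_id ?mulmx0.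
Qed.

Lemma map_mxdiag (R S : nmodType) (f : R -> S) p (p_ : 'I_p -> nat)
    (C : forall i, 'M[R]_(p_ i)) :
  f 0 = 0 -> map_mx f (\mxdiag_i C i) = \mxdiag_i map_mx f (C i).
Proof.
move=> f0; apply/matrixP => i j; rewrite !mxE.
case: eqVneq => [e|_]; last by rewrite !mxE f0.
by move: (tagnat.sig2 j); rewrite -e => j'; rewrite !conform_mx_id mxE.
Qed.

Lemma invmx_mxdiag (R : comUnitRingType) p (p_ : 'I_p -> nat)
    (C : forall i, 'M[R]_(p_ i)) :
  (forall i, C i \in unitmx) -> invmx (\mxdiag_i C i) = \mxdiag_i invmx (C i).
Proof.
move=> uC; apply: invmx_uniq; rewrite mul_mxdiag -mxdiagZ.
by apply: eq_mxdiag => i; rewrite mulmxV.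
Qed.

Lemma unitmx_mxdiag (R : comUnitRingType) p (p_ : 'I_p -> nat)
    (C : forall i, 'M[R]_(p_ i)) :
  (forall i, C i \in unitmx) -> \mxdiag_i C i \in unitmx.
Proof.
move=> uC.
suff /mulmx1_unit[] : \mxdiag_i C i *m \mxdiag_i invmx (C i) = 1%:M by [].
rewrite mul_mxdiag -mxdiagZ.
by apply: eq_mxdiag => i; rewrite mulmxV.
Qed.

Lemma conj_mxdiag (Omega : closedFieldType) p (p_ : 'I_p -> nat)
    (C : forall i, 'M[Omega]_(p_ i)) (d : forall i, 'rV[Omega]_(p_ i)) :
  (forall i, C i \in unitmx) ->
  conj_diag (\mxdiag_i C i) (\mxrow_i d i) = \mxdiag_i conj_diag (C i) (d i).
Proof.
by move=> uC; rewrite /conj_diag diag_mxrow invmx_mxdiag // !mul_mxdiag.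
Qed.

Section ConjDiag.
Variables (Omega : closedFieldType) (n : nat).
Implicit Types (C : 'M[Omega]_n) (d : 'rV[Omega]_n).

Lemma det_conj_diag C d : C \in unitmx ->
  \det (conj_diag C d) = \prod_j d 0 j.
Proof.
move=> uC; rewrite /conj_diag !det_mulmx mulrC mulrA -det_mulmx mulVmx //.
by rewrite det1 mul1r det_diag.
Qed.

Lemma conj_diag_mul C d : C \in unitmx ->
  conj_diag C d *m C = C *m diag_mx d.
Proof. by move=> uC; rewrite /conj_diag mulmxKV. Qed.

Lemma conj_diag_uniq C d A : C \in unitmx ->
  A *m C = C *m diag_mx d -> A = conj_diag C d.
Proof. by move=> uC e; rewrite -[A](mulmxK uC) e. Qed.

Lemma conj_diag_inj C d d' : C \in unitmx ->
  conj_diag C d = conj_diag C d' -> d = d'.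
Proof.
move=> uC /(congr1 (fun A => invmx C *m (A *m C))).
rewrite !conj_diag_mul // !mulKmx // => /matrixP e.
by apply/rowP => j; have := e j j; rewrite !mxE eqxx !mulr1n.
Qed.

Lemma conj_diag_perm C C' d d' (s : 'S_n) :
  C' \in unitmx -> C \in unitmx -> C' = col_perm s C ->
  (forall j, d' 0 (s j) = d 0 j) -> conj_diag C' d = conj_diag C d'.
Proof.
move=> uC' uC eC' ed; symmetry; apply: conj_diag_uniq => //.
rewrite {1}eC' col_permE mulmxA conj_diag_mul // -col_permE.
apply/matrixP => i j; rewrite !mul_mx_diag !mxE ed eC' mxE.
by [].
Qed.

End ConjDiag.

(** * Splitting one Weil restriction *)

Section Component.
Variables (k : fieldType) (Omega : closedFieldType).
Variable iota : {rmorphism k -> Omega}.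
Variables (L : splittingFieldType k) (psi : {rmorphism L -> Omega}).
Hypothesis psiE : forall a, psi a%:A = iota a.
Variables (K : {subfield L}) (r : nat) (b : r.-tuple L).

Lemma card_gal_of : galois 1 K -> \dim K = r -> #|{: gal_of K}| = r.
Proof.
move=> galK <-; have := galois_dim galK; rewrite dimv1 divn1 => ->.
rewrite -cardsT; apply: eq_card => x.
by rewrite inE gal_kHom ?sub1v // k1AHom.
Qed.

Hypothesis bE : basis_of K b.
Hypothesis card_r : #|{: gal_of K}| = r.

Definition gal_nth (j : 'I_r) : gal_of K := enum_val (cast_ord (esym card_r) j).

Lemma gal_nth_inj : injective gal_nth.
Proof. by move=> i j /enum_val_inj/cast_ord_inj. Qed.

Definition gal_mx : 'M[L]_r := \matrix_(l, j) gal_nth j (tnth b l).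

(** A linear relation among the columns, being a relation among the Galois automorphisms on a basis,
    holds on all of [K], against Dedekind's independence. *)
Lemma gal_mx_unit : gal_mx \in unitmx.
Proof.
rewrite -unitmx_tr -row_free_unit -kermx_eq0; apply/rowV0P => v /sub_kermxP v0.
pose c s := \sum_(j | gal_nth j == s) v 0 j.
have c0 : forall s, predT s -> c s = 0.
  apply: gal_independent => a Ka.
  transitivity (\sum_j v 0 j * gal_nth j a).
    rewrite (partition_big gal_nth predT) //=; apply: eq_bigr => s _.
    by rewrite /c mulr_suml; apply: eq_bigr => j /eqP->.
  rewrite (coord_sum bE Ka).
  transitivity (\sum_l (coord b l a)%:A * (v *m gal_mx^T) 0 l).
    under eq_bigr => j do rewrite linear_sum mulr_sumr.
    rewrite exchange_big; apply: eq_bigr => l _ /=.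
    rewrite mxE mulr_sumr; apply: eq_bigr => j _.
    by rewrite !mxE linearZ /= mulr_algl scalerAr.
  by rewrite v0 big1 // => l _; rewrite mxE mulr0.
apply/rowP => j; rewrite mxE -[RHS](c0 (gal_nth j) isT) /c.
by rewrite (big_pred1 j) // => i /=; rewrite (inj_eq gal_nth_inj).
Qed.

Lemma regular_rep_gal x : x \in K ->
  map_mx (in_alg L) (regular_rep b x) *m gal_mx =
  gal_mx *m diag_mx (\row_j gal_nth j x).
Proof.
move=> Kx; apply/matrixP => i j; rewrite mul_mx_diag !mxE -rmorphM /=.
rewrite (regular_rep_sum bE i Kx) linear_sum; apply: eq_bigr => l _.
by rewrite !mxE /= mulr_algl linearZ.
Qed.

Local Notation B := (map_mx psi gal_mx).

Lemma map_gal_mx_unit (f : {rmorphism L -> Omega}) : map_mx f gal_mx \in unitmx.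
Proof. by rewrite map_unitmx gal_mx_unit. Qed.

(** The columns of [gal_mx] are common eigenvectors of the regular representation
    ([regular_rep_gal]). The entries of [a *m B] are the images in [Omega] of the tensor with
    coordinates [a]. *)
Lemma tensor_repE a : tensor_rep iota b a = conj_diag B (a *m B).
Proof.
apply: conj_diag_uniq; first exact: map_gal_mx_unit.
rewrite /tensor_rep mulmx_suml.
transitivity (\sum_l a 0 l *: (B *m diag_mx (row l B))).
  apply: eq_bigr => l _; rewrite -scalemxAl; congr (_ *: _).
  have := congr1 (map_mx psi) (regular_rep_gal (mem_tnth_basis bE l)).
  rewrite !map_mxM map_diag_mx -map_mx_comp (eq_map_mx _ psiE) => ->.
  by congr (_ *m diag_mx _); apply/rowP => j; rewrite !mxE.
rewrite [in RHS]mulmx_sum_row linear_sum mulmx_sumr; apply: eq_bigr => l _.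
by rewrite linearZ scalemxAr.
Qed.

Lemma ResGmP A : ResGm iota b A <->
  exists2 d : 'rV[Omega]_r, (forall j, d 0 j != 0) & A = conj_diag B d.
Proof.
have uB := map_gal_mx_unit psi; split=> [[a [a' [-> /mulmx1_unit[ua _]]]]|].
  exists (a *m B); last exact: tensor_repE.
  move: ua; rewrite tensor_repE unitmxE det_conj_diag // unitfE => nz j.
  by apply: contraNneq nz => j0; rewrite (bigD1 j) //= j0 mul0r.
case=> d nzd ->; exists (d *m invmx B), ((\row_j (d 0 j)^-1) *m invmx B).
rewrite !tensor_repE !mulmxKV // conj_diagM //; split=> //.
rewrite -(conj_diag1 uB); congr conj_diag; apply/rowP => j.
by rewrite !mxE mulfV.
Qed.

(** As [K] is normal, [h] composed with an element of its Galois group is again, on [K], such an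
    element. *)
Lemma gal_nth_perm (h : 'AEnd(L)) : normalField 1 K ->
  {p : 'S_r | forall j, {in K, forall a, h (gal_nth j a) = gal_nth (p j) a}}.
Proof.
move=> nK; have /all_sig[f fP] j :
    {i | {in K, forall a, h (gal_nth j a) = gal_nth i a}}.
  have hj : kHom 1 K (h \o gal_nth j)%VF.
    by rewrite (kHomSr (subvf K)) // (comp_kHom (k1AHom _ _) (k1AHom _ _)).
  have [|x _ xE] := kHom_to_gal _ nK hj; first by rewrite sub1v subvv.
  exists (cast_ord card_r (enum_rank x)) => a Ka.
  by rewrite /gal_nth cast_ordK enum_rankK -xE // lfunE.
have f_inj : injective f.
  move=> i j e; apply/gal_nth_inj/eqP/gal_eqP => a Ka.
  by apply: (fmorph_inj h); rewrite /= !fP // e.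
by exists (perm f_inj) => j a Ka; rewrite fP // permE.
Qed.

End Component.

(** * Split coordinates on the whole product and Galois stability *)

Section SplitCoordinates.
Variables (k : fieldType) (Omega : closedFieldType).
Variable iota : {rmorphism k -> Omega}.
Variables (L : splittingFieldType k) (psi : {rmorphism L -> Omega}).
Hypothesis psiE : forall a, psi a%:A = iota a.
Variables (n : nat) (K : 'I_n.+1 -> {subfield L}) (r : 'I_n.+1 -> nat).
Hypotheses (K_galois : forall i, galois 1 (K i))
  (K_degree : forall i, \dim (K i) = r i).
Variable b : forall i, (r i).-tuple L.
Hypothesis b_basis : forall i, basis_of (K i) (b i).

Local Notation coords := {i : 'I_n.+1 & 'I_(r i)}.
Local Notation at_ i j := (Tagged (fun l => 'I_(r l)) (j : 'I_(r i))).
Let cardK i := card_gal_of (K_galois i) (K_degree i).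
Local Notation sg i := (gal_nth (cardK i)).
Local Notation B i := (gal_mx (b i) (cardK i)).

Let unitB (f : {rmorphism L -> Omega}) i : map_mx f (B i) \in unitmx.
Proof. exact: map_gal_mx_unit. Qed.

Definition split_family (f : L -> Omega) (z : coords -> Omega) :
    mxfamily Omega r :=
  [ffun i => conj_diag (map_mx f (B i)) (\row_j z (at_ i j))].
Local Notation fam := (split_family psi).

Lemma eq_fam z w : z =1 w -> fam z = fam w.
Proof.
move=> e; apply/ffunP => i; rewrite !ffunE; congr conj_diag.
by apply/rowP => j; rewrite !mxE e.
Qed.

Lemma fam_mul z w i : fam z i *m fam w i = fam (fun t => z t * w t) i.
Proof.
rewrite !ffunE conj_diagM //; congr conj_diag.
by apply/rowP => j; rewrite !mxE.
Qed.

Lemma fam_one i (z : coords -> Omega) :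
  (forall j, z (at_ i j) = 1) -> fam z i = 1%:M.
Proof.
move=> z1; rewrite ffunE -(conj_diag1 (unitB psi i)); congr conj_diag.
by apply/rowP => j; rewrite !mxE z1.
Qed.

Lemma det_fam z i : \det (fam z i) = \prod_j z (at_ i j).
Proof.
by rewrite ffunE det_conj_diag //; apply: eq_bigr => j _; rewrite mxE.
Qed.

Lemma fam_inj z w i j : fam z i = fam w i -> z (at_ i j) = w (at_ i j).
Proof.
rewrite !ffunE => /(conj_diag_inj (unitB psi i))/rowP/(_ j).
by rewrite !mxE.
Qed.

Lemma ResGm_fam z i : (forall j, z (at_ i j) != 0) ->
  ResGm iota (b i) (fam z i).
Proof.
move=> nz; apply/(ResGmP psiE (b_basis i) (cardK i)).
by exists (\row_j z (at_ i j)) => [j|]; rewrite ?mxE ?ffunE.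
Qed.

Lemma ResGm_famP (g : mxfamily Omega r) :
  (forall i, ResGm iota (b i) (g i)) ->
  exists2 z, (forall t, z t != 0) & g = fam z.
Proof.
move=> Rg; have /fin_all_exists2[d nzd gE] i :
    exists2 d : 'rV[Omega]_(r i), (forall j, d 0 j != 0) &
      g i = conj_diag (map_mx psi (B i)) d.
  by apply/(ResGmP psiE (b_basis i) (cardK i)).
exists (fun t => d (tag t) 0 (tagged t)) => [[i j]|]; first exact: nzd.
apply/ffunP => i; rewrite ffunE gE; congr conj_diag.
by apply/rowP => j; rewrite mxE.
Qed.

Section Subgroup.
Variable G : mxfamily Omega r -> Prop.
Hypothesis G_alg : algebraic_group_over iota (block_diagonal G).

Lemma block_diagonalE (g : mxfamily Omega r) :
  block_diagonal G (\mxdiag_i g i) <-> G g.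
Proof.
split=> [[g' [Gg' /eq_mxdiagP e]]|Gg]; last by exists g.
by rewrite (_ : g = g') //; apply/ffunP.
Qed.

Lemma G_fam1 : G (fam (fun=> 1)).
Proof.
apply/block_diagonalE; have [[_ G1 _ _] _ _] := G_alg.
rewrite (_ : \mxdiag_i _ = 1%:M) // -mxdiagZ.
by apply: eq_mxdiag => i; apply: fam_one.
Qed.

Lemma G_famM z w : G (fam z) -> G (fam w) -> G (fam (fun t => z t * w t)).
Proof.
move=> /block_diagonalE Gz /block_diagonalE Gw; apply/block_diagonalE.
have [[_ _ GM _] _ _] := G_alg; have := GM _ _ Gz Gw.
rewrite mul_mxdiag; congr block_diagonal; apply: eq_mxdiag => i.
exact: fam_mul.
Qed.

Lemma G_famV z : (forall t, z t != 0) -> G (fam z) ->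
  G (fam (fun t => (z t)^-1)).
Proof.
move=> nz /block_diagonalE Gz; apply/block_diagonalE.
have [[_ _ _ GV] _ _] := G_alg; have := GV _ Gz.
congr block_diagonal; apply: invmx_uniq; rewrite mul_mxdiag -mxdiagZ.
apply: eq_mxdiag => i; rewrite fam_mul fam_one // => j.
by rewrite mulfV.
Qed.

Lemma G_fam_prod (I : finType) (P : pred I) (z : I -> coords -> Omega) :
  (forall i, P i -> G (fam (z i))) -> G (fam (fun t => \prod_(i | P i) z i t)).
Proof.
move=> Gz; rewrite /index_enum; elim: (Finite.enum I) => [|i s IHs].
  by rewrite (eq_fam (w := fun=> 1)) => [|t]; [apply: G_fam1 | rewrite big_nil].
have [Pi|nPi] := boolP (P i).
  by rewrite (eq_fam (w := fun t => z i t * \prod_(j <- s | P j) z j t)) => [|t];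
    [apply: G_famM; first exact: Gz | rewrite big_cons Pi].
by rewrite (eq_fam (w := fun t => \prod_(j <- s | P j) z j t)) // => t;
  rewrite big_cons (negPf nPi).
Qed.

(* The group is stable under permutations of the split coordinates coming     *)
(* from Galois, with no action on the values of the coordinates.              *)
Lemma G_fam_perm (h : 'AEnd(L)) (p : forall i, 'S_(r i)) z :
  (forall i j, {in K i, forall a, h (sg i j a) = sg i (p i j) a}) ->
  G (fam z) -> G (fam (fun t => z (at_ (tag t) ((p (tag t))^-1%g (tagged t))))).
Proof.
move=> hp /block_diagonalE Gz; apply/block_diagonalE.
pose psi' : {rmorphism L -> Omega} := psi \o h.
have hA a : psi' a%:A = iota a.
  by rewrite /= linearZ /= rmorph1 psiE.
pose d i : 'rV[Omega]_(r i) := \row_j z (at_ i j).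
have famd f : \mxdiag_i split_family f z i =
    \mxdiag_i conj_diag (map_mx f (B i)) (d i).
  by apply: eq_mxdiag => i; rewrite ffunE.
have uB : \mxdiag_i B i \in unitmx.
  by apply: unitmx_mxdiag => i; apply: gal_mx_unit.
rewrite famd -conj_mxdiag // -map_mxdiag ?rmorph0 // in Gz.
have := twist_mem uB G_alg psiE hA Gz.
rewrite map_mxdiag ?rmorph0 // conj_mxdiag //.
congr block_diagonal; apply: eq_mxdiag => i; rewrite ffunE.
(* Column [j] of the image of [B i] under [h] is column [p i j] of [B i], so the change of embedding
   amounts to permuting the diagonal. *)
apply: (conj_diag_perm (s := p i)) => //.
  by apply/matrixP => l j; rewrite !mxE /= hp // (mem_tnth_basis (b_basis i)).
by move=> j; rewrite !mxE /= permK.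
Qed.

End Subgroup.

(** * The subgroup exhausts the equal-norm torus *)

Section Main.
Variable G : mxfamily Omega r -> Prop.
Hypothesis G_alg : algebraic_group_over iota (block_diagonal G).
Hypothesis r_gt0 : forall i, (0 < r i)%N.
Hypothesis K_disjoint :
  forall i, i != ord_max -> linearly_disjoint (K i) (K ord_max).
Hypothesis G_sub : forall g, G g -> equal_det_group iota b g.
Hypothesis G_init : forall y,
  equal_det_group iota (fun i : 'I_n => b (widen_ord (leqnSn n) i)) y ->
  exists2 g, G g & proj_init g = y.
Hypothesis G_last : forall y, ResGm iota (b ord_max) y ->
  exists2 g, G g & proj_last g = y.

(** Surjectivity onto T_(n-1), in coordinates: [w] is prescribed outside the last block and unknown
    inside it. *)
Lemma lift_fam z : (forall t, z t != 0) ->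
  (forall i j, i != ord_max -> j != ord_max ->
     \det (fam z i) = \det (fam z j)) ->
  exists2 w, (forall t, w t != 0) /\
             (forall t, tag t != ord_max -> w t = z t)
           & G (fam w).
Proof.
move=> nz eqd; have [|g Gg gE] := G_init (y := proj_init (fam z)).
  have pE i : proj_init (fam z) i = fam z (widen_ord (leqnSn n) i).
    by rewrite ffunE.
  split=> [i|i j]; rewrite !pE; first exact: ResGm_fam.
  by apply: eqd; rewrite -val_eqE /= neq_ltn ltn_ord.
have [w nzw gw] := ResGm_famP (G_sub Gg).1; exists w; last by rewrite -gw.
split=> // -[i j] /= ni; apply: fam_inj; rewrite -gw.
have lt_i : (i < n)%N by rewrite ltn_neqAle -ltnS ltn_ord andbT.
have := congr1 (fun f : mxfamily _ _ => f (Ordinal lt_i)) gE.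
rewrite !ffunE.
by have -> : widen_ord (leqnSn n) (Ordinal lt_i) = i by apply: val_inj.
Qed.

(* Dividing the Galois twist of a lift of [z0] by that lift kills all the     *)
(* other coordinates; the scalar [y] only serves to make the norm equal to 1. *)
Lemma G_elementary i (j0 j : 'I_(r i)) x : i != ord_max -> x != 0 ->
  G (fam (fun t => (if t == at_ i j then x else 1) /
                   (if t == at_ i j0 then x else 1))).
Proof.
move=> ni nzx; have [y yx] : exists y : Omega, y ^+ r i = x^-1.
  have [|y] := @closed_rootP Omega ('X^(r i) - (x^-1)%:P) _.
    by rewrite size_XnsubC // eqSS -lt0n.
  by rewrite /root !hornerE subr_eq0 => /eqP; exists y.
have nzy : y != 0.
  apply: contraTneq nzx => y0; rewrite -invr_eq0 -yx y0 expr0n.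
  by rewrite gtn_eqF ?r_gt0 ?eqxx.
pose e (s : coords) t : Omega := if t == s then x else 1.
have nze s t : e s t != 0 by rewrite /e; case: ifP; rewrite ?oner_eq0.
pose z0 t := if tag t == i then y * e (at_ i j0) t else 1.
have [||w [nzw wE] Gw] := @lift_fam z0.
- by move=> t; rewrite /z0; case: ifP => _; rewrite ?mulf_neq0 ?oner_eq0.
- suff d1 i' : \det (fam z0 i') = 1 by move=> *; rewrite !d1.
  rewrite det_fam; have [->|ne] := eqVneq i' i; last first.
    by rewrite big1 // => j' _; rewrite /z0 /= (negPf ne).
  under eq_bigr => j' _ do rewrite /z0 /= eqxx /e eq_Tagged.
  rewrite big_split /= prodr_const card_ord yx -big_mkcond big_pred1_eq.
  by rewrite mulVf.
(* The product in [gal_of] applies its left factor first, so [h] carries [sg i j0] to [sg i j]. *)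
have [h [hfix hE]] := linearly_disjoint_gal ((sg i j0)^-1 * sg i j)%g
  (let: And3 _ s _ := and3P (K_galois i) in s) (K_disjoint ni).
have nK i' : normalField 1 (K i') by case/and3P: (K_galois i').
have /all_sig[p pE] i' : {p : 'S_(r i') |
    forall j', {in K i', forall a, h (sg i' j' a) = sg i' (p j') a}}.
  exact: gal_nth_perm.
have pj0 : p i j0 = j.
  apply/(gal_nth_inj (card_r := cardK i))/eqP/gal_eqP => a Ka.
  by rewrite -pE // hE ?memv_gal // -galM ?memv_gal // mulgA mulgV mul1g.
have plast j' : p ord_max j' = j'.
  apply/(gal_nth_inj (card_r := cardK _))/eqP/gal_eqP => a Ka.
  by rewrite -pE // hfix ?memv_gal.
(* In this quotient the last block cancels because [p ord_max] is trivial, the other blocks besides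
   [i] were constantly 1, and in block [i] the scalar [y] cancels. *)
have := G_famM G_alg (G_fam_perm G_alg pE Gw) (G_famV G_alg nzw Gw).
congr G; apply: eq_fam => -[i' j'] /=; rewrite -!/(e _ _).
have [ei|ni'] := eqVneq i' ord_max.
  subst i'; have -> : ((p ord_max)^-1)%g j' = j'.
    by apply: (perm_inj (s := p ord_max)); rewrite permKV plast.
  by rewrite mulfV // /e -!tag_eqE /tag_eq /= eq_sym (negPf ni) divr1.
rewrite !wE // /z0 /=; case: eqVneq => [ei|ne]; last first.
  by rewrite /e -!tag_eqE /tag_eq /= (negPf ne) divr1.
subst i'; rewrite /e !eq_Tagged -pj0.
rewrite -(inj_eq (perm_inj (s := p i))) permKV.
by rewrite invfM mulrACA mulfV // mul1r.
Qed.

(** In each block but the last, every coordinate away from a base point [o i] is produced by one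
    elementary element, which puts its inverse at [o i]. The value accumulated at [o i] is the right
    one because the block has product 1. *)
Lemma G_norm1 z : (forall t, z t != 0) ->
  (forall j, z (at_ ord_max j) = 1) ->
  (forall i, \prod_j z (at_ i j) = 1) -> G (fam z).
Proof.
move=> nz zlast z1; pose o i : 'I_(r i) := Ordinal (r_gt0 i).
pose P (a : coords) := (tag a != ord_max) && (tagged a != o (tag a)).
pose e i (j : 'I_(r i)) t := (if t == at_ i j then z (at_ i j) else 1) /
    (if t == at_ i (o i) then z (at_ i j) else 1).
have := @G_fam_prod G G_alg _ P (fun a => e (tag a) (tagged a)).
rewrite (eq_fam (w := z)) => [|[i j]].
  by apply=> -[i j] /andP[ni _]; apply: G_elementary.
rewrite -(sig_big_dep (fun i => i != ord_max) (fun i j => j != o i)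
  (fun i' j' => e i' j' (at_ i j))) {}/e /=.
have tagN i' (j' : 'I_(r i')) : i' != i -> (at_ i j == at_ i' j') = false.
  by move=> ne; rewrite -tag_eqE /tag_eq /= eq_sym (negPf ne).
have [ei|ni] := eqVneq i ord_max.
  rewrite big1 => [|i' ni']; first by subst i; rewrite zlast.
  by rewrite big1 // => j' _; rewrite !tagN ?ei ?divr1.
rewrite (bigD1 i) //= [X in _ * X]big1 ?mulr1 => [|i' /andP[_ ne]]; last first.
  by rewrite big1 // => j' _; rewrite !tagN // divr1.
under eq_bigr => j' _ do rewrite !eq_Tagged /=.
have [->|nej] := eqVneq j (o i); last first.
  rewrite (bigD1 j) //= eqxx divr1 big1 ?mulr1 // => j' /andP[_ ne].
  by rewrite eq_sym (negPf ne) divr1.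
have := z1 i; rewrite (bigD1 (o i)) //= => /(canRL (mulfK _)) ->; last first.
  by apply/prodf_neq0.
rewrite mul1r -prodfV; apply: eq_bigr => j' ne.
by rewrite eq_sym (negPf ne) mul1r.
Qed.

(** Divide [g] by an element of [G] with the same last component: since dets agree across the blocks
    of each, the quotient has det 1 in every block, and [G_norm1] applies. *)
Lemma G_full g : equal_det_group iota b g -> G g.
Proof.
move=> [Rg dg]; have [z nz gz] := ResGm_famP Rg; subst g.
have [g Gg gE] := G_last (Rg ord_max).
have [Rw dw] := G_sub Gg; have [w nzw gw] := ResGm_famP Rw; subst g.
have ezw j : w (at_ ord_max j) = z (at_ ord_max j) by exact: fam_inj.
rewrite (eq_fam (w := fun t => z t / w t * w t)) => [|t]; last by rewrite divfK.
apply: G_famM => //; apply: G_norm1 => [t|j|i].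
- by rewrite mulf_neq0 ?invr_eq0.
- by rewrite ezw mulfV.
- rewrite prodf_div -!det_fam (dg i ord_max) (dw i ord_max).
  rewrite -/(proj_last _) -[fam w ord_max]/(proj_last _) gE mulfV //.
  by rewrite det_fam; apply/prodf_neq0.
Qed.

End Main.
End SplitCoordinates.

Theorem theorem4p2
  (F : finFieldType)
  (Omega : closedFieldType) (iota : {rmorphism ratfun F -> Omega})
  (Omega_algebraic : forall x : Omega, algebraicOver iota x)
  (L : splittingFieldType (ratfun F))
  (n : nat) (n_ge2 : (2 <= n.+1)%N)
  (K : 'I_n.+1 -> {subfield L}) (r : 'I_n.+1 -> nat)
  (K_galois : forall i, galois 1 (K i))
  (K_degree : forall i, \dim (K i) = r i)
  (r_ge2 : forall i, (2 <= r i)%N)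
  (K_disjoint : forall i j, i != j -> linearly_disjoint (K i) (K j))
  (b : forall i, (r i).-tuple L)
  (b_basis : forall i, basis_of (K i) (b i))
  (G : mxfamily Omega r -> Prop)
  (G_torus : torus_over iota (block_diagonal G))
  (G_sub : forall g, G g -> equal_det_group iota b g)
  (G_init : image_eq (@proj_init Omega n r) G
     (equal_det_group iota (fun i : 'I_n => b (widen_ord (leqnSn n) i))))
  (G_last : image_eq (@proj_last Omega n r) G (ResGm iota (b ord_max))) :
  forall g, G g <-> equal_det_group iota b g.
Proof.
move=> g; split; first exact: G_sub.
have [psi psiE] := closed_embedding iota L.
apply: (G_full psiE K_galois K_degree b_basis G_torus.1) => //.
- by move=> i; apply: leq_trans (r_ge2 i).
- by move=> i; apply: K_disjoint.
- by move=> y /G_init.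
- by move=> y /G_last.
Qed.
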